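(* Let $\Gamma \leqslant \mathrm{N}_{\mathrm{GL}(X_{\mathbb{R}})}(W)$ be a finite subgroup, let $(-\mid-)$ be a $W\Gamma$-invariant positive definite symmetric bilinear form on $X_{\mathbb{R}}$, and let $\theta : X_{\mathbb{R}}\to X_{\mathbb{R}}^{\Gamma}$ be the orthogonal projection onto the subspace of $\Gamma$-fixed vectors. For any subset $\Sigma\subseteq\Phi$, the set $\Phi\cap\theta^{-1}(\theta(X_{\mathbb{R},\Sigma}))$ is the smallest $\Gamma$-split Levi subsystem containing $\Sigma$ (that is, it is a $\Gamma$-split Levi subsystem containing $\Sigma$, and it is contained in every $\Gamma$-split Levi subsystem containing $\Sigma$). In particular, $\Sigma$ is a $\Gamma$-split Levi subsystem if and only if $\Sigma=\Phi\cap\theta^{-1}(\theta(X_{\mathbb{R},\Sigma}))$.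
   Context: Let $(X,\check{X})$ be a pair of finite rank free $\mathbb{Z}$-modules with a perfect pairing $\langle-,-\rangle : X\times\check{X}\to\mathbb{Z}$, and let $X_{\mathbb{R}} = \mathbb{R}\otimes_{\mathbb{Z}}X$. Let $\Phi\subseteq X$ be a non-empty finite subset with an injection $\Phi\to\check{X}$, $\alpha\mapsto\check{\alpha}$, such that $\langle\alpha,\check\alpha\rangle=2$ and $s_{\alpha,\check\alpha}(\Phi)\subseteq\Phi$ for all $\alpha\in\Phi$, where $s_{\alpha,\check\alpha}(x)=x-\langle x,\check\alpha\rangle\alpha$. Then $\Phi$ is a root system in its real span, and it is assumed to be reduced. Let $W=\langle s_{\alpha,\check\alpha}\mid\alpha\in\Phi\rangle\leqslant\mathrm{GL}(X_{\mathbb{R}})$, a finite group. For $\Sigma\subseteq X_{\mathbb{R}}$, $X_{\mathbb{R},\Sigma}\subseteq X_{\mathbb{R}}$ denotes the $\mathbb{R}$-subspace spanned by $\Sigma$. A subset $\Psi\subseteq\Phi$ is closed if $\alpha,\beta\in\Psi$ and $\alpha+\beta\in\Phi$ imply $\alpha+\beta\in\Psi$; it is parabolic if it is closed and $\Psi\cup(-\Psi)=\Phi$. Each $g\in\Gamma$ permutes the lines spanned by roots, and there is a unique permutation $\rho_g:\Phi\to\Phi$ such that $g\alpha=c_{g,\alpha}\rho_g(\alpha)$ with $c_{g,\alpha}>0$ real. $\Phi$ is regarded as a $\Gamma$-set via $g\mapsto\rho_g$. A subset $\Sigma\subseteq\Phi$ is a $\Gamma$-split Levi subsystem if $\Sigma=\Psi\cap(-\Psi)$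 for some $\Gamma$-stable parabolic subset $\Psi\subseteq\Phi$. Explicitly, $\theta v=\frac{1}{|\Gamma|}\sum_{g\in\Gamma}gv$ for $v \in X_{\mathbb{R}}$. *)

(* Defs.v *)
From HB Require Import structures.
From mathcomp Require Import all_boot all_order all_algebra.
From mathcomp Require Import finmap.
From mathcomp Require Import boolp classical_sets reals.

Set Implicit Arguments.
Unset Strict Implicit.
Unset Printing Implicit Defensive.

Import Order.TTheory GRing.Theory Num.Theory.

Local Open Scope classical_set_scope.
Local Open Scope fset_scope.
Local Open Scope ring_scope.

(* Finite rank free Z-modules are rendered as objects of type [vectType int]:
   Z-modules that are linearly isomorphic to some 'rV[int]_n.  Likewise
   finite-dimensional real vector spaces are [vectType R]. *)

Section Lattices.
Variables (X Xc : vectType int).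

(* Both maps X -> Hom(Xc, Z) and Xc -> Hom(X, Z) induced by the pairing are
   bijective. *)
Definition perfect_pairing (pair : {bilinear X -> Xc -> int | *%R & *%R}) :=
  (forall f : {scalar Xc}, exists! x : X, forall y, pair x y = f y) /\
  (forall f : {scalar X}, exists! y : Xc, forall x, pair x y = f x).

Variable pair : {bilinear X -> Xc -> int | *%R & *%R}.

Definition reflection (a : X) (ac : Xc) (x : X) : X := x - pair x ac *: a.

Definition root_axioms (coroot : X -> Xc) (Phi : {fset X}) :=
  [/\ Phi != fset0,
      {in Phi &, injective coroot},
      {in Phi, forall a, pair a (coroot a) = 2} &
      {in Phi &, forall a b, reflection a (coroot a) b \in Phi}].

Definition fset_opp (Psi : {fset X}) : {fset X} := [fset - a | a in Psi].

Definition closed_subset (Phi Psi : {fset X}) :=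
  Psi `<=` Phi /\
  {in Psi &, forall a b, a + b \in Phi -> a + b \in Psi}.

Definition parabolic (Phi Psi : {fset X}) :=
  closed_subset Phi Psi /\ Psi `|` fset_opp Psi = Phi.

End Lattices.

(* Universal property of the extension of scalars x |-> 1 (x) x from X to
   R (x)_Z X: every additive map from X to a real vector space W extends
   uniquely to an R-linear map V -> W. *)
Definition real_extension (R : realType) (X : vectType int) (V : vectType R)
    (iota : {additive X -> V}) :=
  forall (W : lmodType R) (f : {additive X -> W}),
    exists F : {linear V -> W},
      (forall x, F (iota x) = f x) /\
      (forall G : {linear V -> W}, (forall x, G (iota x) = f x) -> G =1 F).

Section GeneralLinear.
Variables (R : realType) (V : vectType R).

Definition GL : set 'End(V) := [set f | lker f == 0%VS].

Definition GL_subgroup (G : set 'End(V)) :=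
  [/\ (G `<=` GL)%classic,
      G \1%VF,
      (forall f g, G f -> G g -> G (f \o g)%VF) &
      (forall f, G f -> G (f^-1)%VF)].

Definition GL_generated (S : set 'End(V)) : set 'End(V) :=
  [set f | forall G, GL_subgroup G -> (S `<=` G)%classic -> G f].

Definition GL_normalizer (G : set 'End(V)) : set 'End(V) :=
  [set g | GL g /\ [set (g \o f \o g^-1)%VF | f in G]%classic = G].

Definition invariants (Gamma : {fset 'End(V)}) : {vspace V} :=
  (\bigcap_(g <- Gamma) fixedSpace g)%VS.

Definition orthogonal_projection (form : {dot V for idfun})
    (U : {vspace V}) (p : 'End(V)) :=
  forall v, p v \in U /\ (forall u, u \in U -> form (v - p v) u = 0).

End GeneralLinear.

Section RealRoots.
Variables (R : realType) (X Xc : vectType int) (V : vectType R).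
Variables (iota : {additive X -> V}).

Definition reduced (Phi : {fset X}) :=
  forall a b (c : R), a \in Phi -> b \in Phi -> iota b = c *: iota a ->
    b = a \/ b = - a.

(* The Weyl group; a generator is the R-linear extension of a reflection
   of X. *)
Definition weyl_group (pair : {bilinear X -> Xc -> int | *%R & *%R})
    (coroot : X -> Xc) (Phi : {fset X}) : set 'End(V) :=
  GL_generated [set s : 'End(V) | exists2 a, a \in Phi &
    forall x, s (iota x) = iota (reflection pair a (coroot a) x)]%classic.

Definition real_span (Sigma : {fset X}) : {vspace V} :=
  <<[seq iota a | a <- Sigma]>>%VS.

Variable Phi : {fset X}.

(* The permutation rho_g of Phi: g a is a positive multiple of
   [root_action g a].  When Phi is reduced and g normalizes the Weyl group
   such a root exists and is unique, so the default value a of [xget] is never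
   used for a in Phi. *)
Definition root_action (g : 'End(V)) (a : X) : X :=
  xget a [set b : X | b \in Phi /\
            exists2 c : R, 0 < c & g (iota a) = c *: iota b]%classic.

Definition stable (Gamma : {fset 'End(V)}) (Psi : {fset X}) :=
  {in Gamma, forall g, {in Psi, forall a, root_action g a \in Psi}}.

Definition split_levi (Gamma : {fset 'End(V)}) (Sigma : {fset X}) :=
  exists Psi : {fset X},
    [/\ parabolic Phi Psi, stable Gamma Psi & Sigma = Psi `&` fset_opp Psi].

Definition levi_closure (theta : 'End(V)) (Sigma : {fset X}) : {fset X} :=
  [fset a in Phi | iota a \in (theta @^-1: (theta @: real_span Sigma))%VS].

End RealRoots.

(* Main.v *)
(** Write (x|y) for the form; for a vector v fixed by Gamma, (v|x) = (v|theta x).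
    Choosing such a v orthogonal to theta(X_{R,Sigma}) but not to theta(a) for
    any root a outside the closure of Sigma, the roots with (v|a) >= 0 form a
    Gamma-stable parabolic subset with Levi part the closure.  Conversely, if
    Psi is a Gamma-stable parabolic subset, the sum of the roots in Psi \ (-Psi)
    pairs nonnegatively with Psi and positively with Psi \ (-Psi); averaging it
    over Gamma gives a fixed vector with the same properties, so Levi(Psi) is cut
    out of Phi by the orthogonality to a Gamma-fixed vector and therefore
    contains the closure of each of its subsets.  The averaging needs that Gamma
    permutes the rays spanned by the roots, i.e. that every reflection in W is a
    reflection in a root. *)

Require Import Defs.
From HB Require Import structures.
From mathcomp Require Import all_boot all_order all_algebra.
From mathcomp Require Import finmap.
From mathcomp Require Import boolp classical_sets reals.
From mathcomp Require Import zify ring lra.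

Set Implicit Arguments.
Unset Strict Implicit.
Unset Printing Implicit Defensive.

Import Order.TTheory GRing.Theory Num.Theory.
Import passmx.

Local Open Scope classical_set_scope.
Local Open Scope fset_scope.
Local Open Scope ring_scope.

(** * Reindexing, a rank-one determinant, and nonroots of polynomials *)

Lemma perm_map_stable (T : eqType) (s : seq T) (f : T -> T) :
  uniq s -> {in s &, injective f} -> {in s, forall x, f x \in s} ->
  perm_eq (map f s) s.
Proof.
move=> s_uniq f_inj f_stable.
have fs_uniq : uniq (map f s) by rewrite map_inj_in_uniq.
have sub : {subset map f s <= s} by move=> _ /mapP[x xs ->]; exact: f_stable.
apply: uniq_perm => //.
by have [] := uniq_min_size fs_uniq sub; rewrite ?size_map.
Qed.

(** Both products in the proof equal the matrix with blocks 1, [c], [r], 1; the identity compares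
    the determinants of these two triangular factorizations. *)
Lemma det_1Bmul (K : comNzRingType) n (c : 'cV[K]_n) (r : 'rV[K]_n) :
  \det (1%:M - c *m r) = 1 - (r *m c) 0 0.
Proof.
have /(congr1 determinant) :
    block_mx (1%:M - c *m r) c 0 1%:M *m block_mx 1%:M 0 r 1%:M =
    block_mx 1%:M 0 r 1%:M *m block_mx 1%:M c 0 (1%:M - r *m c) :> 'M_(n + 1).
  rewrite !mulmx_block !mulmx1 !mul1mx !mulmx0 !mul0mx !addr0 !add0r.
  by rewrite subrK addrC subrK.
rewrite !det_mulmx !det_ublock !det_lblock !det1 !mul1r !mulr1 => ->.
by rewrite det_mx11 !mxE.
Qed.

(** The integers 0, ..., [size p - 1] are distinct in [F], and a nonzero [p] has fewer than [size p]
    roots. *)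
Lemma exists_nonroot (F : numDomainType) (p : {poly F}) :
  p != 0 -> exists t, ~~ root p t.
Proof.
move=> p_neq0; apply: contrapT => /forallNP root_p.
pose s : seq F := [seq i%:R | i <- iota 0 (size p)].
have: (size s < size p)%N.
  apply: max_poly_roots => //.
    by apply/allP => t _; apply/negPn/negP/root_p.
  by rewrite map_inj_uniq ?iota_uniq //; exact: mulrIn (oner_neq0 F).
by rewrite size_map size_iota ltnn.
Qed.

(** * The determinant of an endomorphism *)

Section EndDet.
Variables (F : fieldType) (V : vectType F).

(** Restricted to W, this is the sign character by which the product of the positive roots
    transforms. *)
Definition enddet (f : 'End(V)) : F :=
  \det (mxof (vbasis {:V}) (vbasis {:V}) f).

Lemma enddet_comp f g : enddet (f \o g)%VF = enddet f * enddet g.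
Proof.
by rewrite /enddet (mxof_comp _ _ (vbasisP _)) det_mulmx mulrC.
Qed.

Lemma enddet1 : enddet \1%VF = 1.
Proof.
rewrite /enddet (_ : mxof _ _ _ = 1%:M) ?det1 //.
apply/row_matrixP => i; rewrite !rowE mul_mxof id_lfunE mulmx1 vecofK //.
exact: vbasisP.
Qed.

End EndDet.

(** * Euclidean geometry and orthogonal reflections *)

Section DotGeometry.
Variables (R : realFieldType) (V : vectType R) (form : {dot V for idfun}).
Implicit Types (u v w x y : V) (a : R).
Local Notation "''[' u , v ]" := (form u v) (format "''[' u ,  v ]").

Lemma dotC u v : '[u, v] = '[v, u].
Proof. by rewrite (hermitian_subproof u v) mul1r. Qed.

Lemma dotDr u v w : '[u, v + w] = '[u, v] + '[u, w].
Proof. exact: linearDr. Qed.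

Lemma dotBr u v w : '[u, v - w] = '[u, v] - '[u, w].
Proof. exact: linearBr. Qed.

Lemma dotNr u v : '[u, - v] = - '[u, v].
Proof. exact: linearNr. Qed.

Lemma dot0r u : '[u, 0] = 0.
Proof. exact: linear0r. Qed.

Lemma dotZr a u v : '[u, a *: v] = a * '[u, v].
Proof. exact: linearZr_LR. Qed.

Lemma dotDl u v w : '[u + v, w] = '[u, w] + '[v, w].
Proof. exact: linearDl. Qed.

Lemma dotBl u v w : '[u - v, w] = '[u, w] - '[v, w].
Proof. exact: linearBl. Qed.

Lemma dotNl u v : '[- u, v] = - '[u, v].
Proof. exact: linearNl. Qed.

Lemma dotZl a u v : '[a *: u, v] = a * '[u, v].
Proof. exact: linearZl_LR. Qed.

Lemma dot_suml (I : Type) (r : seq I) (P : pred I) (f : I -> V) v :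
  '[\sum_(i <- r | P i) f i, v] = \sum_(i <- r | P i) '[f i, v].
Proof. exact: linear_sumlz. Qed.

Lemma dot_sumr (I : Type) (r : seq I) (P : pred I) (f : I -> V) v :
  '[v, \sum_(i <- r | P i) f i] = \sum_(i <- r | P i) '[v, f i].
Proof. by rewrite dotC dot_suml; apply: eq_bigr => i _; rewrite dotC. Qed.

Lemma dot_gt0 u : (0 < '[u, u]) = (u != 0).
Proof.
apply/idP/idP; last exact: neq0_dnorm_gt0.
by apply: contraTneq => ->; rewrite dot0r ltxx.
Qed.

Lemma dot_eq0 u : ('[u, u] == 0) = (u == 0).
Proof.
have [->|/[dup] u0] := eqVneq u 0; first by rewrite dot0r eqxx.
by rewrite -dot_gt0 => /gt_eqF.
Qed.

Lemma dot_span_eq0 (s : seq V) u v :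
  (forall w, w \in s -> '[u, w] = 0) -> v \in <<s>>%VS -> '[u, v] = 0.
Proof.
move=> us; rewrite -[s]/(tval (in_tuple s)) => /coord_span ->.
rewrite dot_sumr big1 // => i _.
by rewrite dotZr us ?mulr0 // mem_nth.
Qed.

Lemma span_orthogonal_decomposition (s : seq V) x :
  exists2 p, p \in <<s>>%VS & forall y, y \in <<s>>%VS -> '[x - p, y] = 0.
Proof.
elim: s x => [|w s IH] x.
  exists 0; first exact: mem0v.
  by rewrite span_nil => y; rewrite memv0 => /eqP->; rewrite dot0r.
have [p ps xp] := IH x; have [q qs wq] := IH w.
have sub : (<<s>> <= <<w :: s>>)%VS by rewrite span_cons addvSr.
(* Gram-Schmidt step: [w - q] is the new orthogonal direction and [t] the coefficient of [x - p]
   along it. *)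
pose t := '[x - p, w - q] / '[w - q, w - q].
have w_in : w \in <<w :: s>>%VS by rewrite memv_span ?mem_head.
exists (p + t *: (w - q)).
  by apply: memvD; [|apply/memvZ/memvB => //]; exact: (subvP sub).
move=> y; apply: dot_span_eq0 => z.
have orth_s y' : y' \in <<s>>%VS -> '[x - (p + t *: (w - q)), y'] = 0.
  by move=> y's; rewrite opprD addrA dotBl dotZl wq // xp // mulr0 subr0.
rewrite inE => /predU1P[->|/memv_span /orth_s //].
have -> : '[x - (p + t *: (w - q)), w] = '[x - (p + t *: (w - q)), w - q].
  by rewrite [RHS]dotBr (orth_s q) ?subr0.
rewrite opprD addrA dotBl dotZl.
have [->|wq0] := eqVneq (w - q) 0; first by rewrite !dot0r mulr0 subr0.
by rewrite /t divfK ?subrr // dot_eq0.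
Qed.

(** If [u] avoids the hyperplanes of [s] and [u'] avoids that of [w], then [u + t *: u'] avoids all
    of them for all but finitely many [t]. *)
Lemma avoid_hyperplanes (U : {vspace V}) (s : seq V) :
  (forall w, w \in s -> exists2 u, u \in U & '[u, w] != 0) ->
  exists2 u, u \in U & forall w, w \in s -> '[u, w] != 0.
Proof.
elim: s => [|w s IH] ws; first by exists 0; rewrite ?mem0v.
have [u uU us] := IH (fun z zs => ws z (mem_behead (s := w :: s) zs)).
have [u' u'U u'w] := ws w (mem_head _ _).
(* The value of [p] at [t] is the product of the ['[u + t *: u', z]]. No factor is the zero
   polynomial: look at the coefficient of degree 1 for [z = w], and at the constant term for [z] in
   [s]. *)
pose p := \prod_(z <- w :: s) ('[u, z]%:P + '[u', z] *: 'X).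
have p_neq0 : p != 0.
  rewrite prodf_seq_neq0; apply/allP => z zs /=; apply/negP => /eqP /polyP z0.
  have := z0 0%N; have := z0 1%N.
  rewrite !coefE /= add0r !mulr0 !mulr1 !addr0.
  move: zs; rewrite inE => /predU1P[->|zs]; first by move/eqP; rewrite (negPf u'w).
  by move=> _ /eqP; rewrite (negPf (us _ zs)).
have [t /rootP pt] := exists_nonroot p_neq0.
exists (u + t *: u'); first by rewrite memvD ?memvZ.
move=> z zs; apply: contra_not_neq pt => uz.
rewrite horner_prod; apply/eqP; rewrite prodf_seq_eq0.
apply/hasP; exists z => //=.
by rewrite !hornerE /= mulrC -dotZl -dotDl uz.
Qed.

Lemma mem_orth_line u v : (u \in orthov form <[v]>%VS) = ('[u, v] == 0).
Proof. exact: mem_orthov1. Qed.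

(** The vector [v - c *: u] is orthogonal to [u], hence by assumption to [v], hence to itself. *)
Lemma orth_sub_line u v : u != 0 ->
  (forall x, '[x, u] = 0 -> '[x, v] = 0) -> v = ('[v, u] / '[u, u]) *: u.
Proof.
move=> u0 uv; set c := _ / _.
have xu : '[v - c *: u, u] = 0 by rewrite dotBl dotZl divfK ?subrr ?dot_eq0.
apply/eqP; rewrite -subr_eq0 -dot_eq0 dotBr dotZr xu uv //.
by rewrite mulr0 subr0.
Qed.

(** For [u = 0] this is the identity, so linearity and [reflK] hold for every [u]. *)
Definition refl_fun u y : V := y - (2 * '[y, u] / '[u, u]) *: u.

Fact refl_fun_linear u : linear (refl_fun u).
Proof.
move=> a y z; rewrite /refl_fun dotDl dotZl mulrDr mulrDl scalerDl scalerBr.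
rewrite scalerA -!addrA; congr (_ + _); rewrite addrCA opprD; congr (_ + _).
by congr (- (_ *: _) - _); ring.
Qed.
HB.instance Definition _ u :=
  GRing.isLinear.Build R V V *:%R (refl_fun u) (refl_fun_linear u).

Definition refl u : 'End(V) := linfun (refl_fun u).

Lemma reflE u y : refl u y = y - (2 * '[y, u] / '[u, u]) *: u.
Proof. by rewrite lfunE. Qed.

Lemma refl_id u : u != 0 -> refl u u = - u.
Proof.
by move=> u0; rewrite reflE mulfK ?dot_eq0 // scaler_nat mulr2n opprD addrA subrr add0r.
Qed.

Lemma refl_orth u y : '[y, u] = 0 -> refl u y = y.
Proof. by move=> yu; rewrite reflE yu mulr0 mul0r scale0r subr0. Qed.

Lemma refl_adjoint u x y : '[refl u x, y] = '[x, refl u y].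
Proof.
by rewrite !reflE dotBl dotBr dotZl dotZr (dotC y u); congr (_ - _); ring.
Qed.

Lemma reflK u : involutive (refl u).
Proof.
have [->|u0] := eqVneq u 0 => y; first by rewrite !reflE !scaler0 !subr0.
rewrite [refl u y]reflE linearB linearZ /= refl_id // reflE scalerN.
by rewrite opprK subrK.
Qed.

Lemma reflN u : refl (- u) = refl u.
Proof.
apply/lfunP => y; rewrite !reflE !(dotNr, dotNl) opprK scalerN.
by rewrite mulrN mulNr scaleNr opprK.
Qed.

Lemma refl_in_GL u : lker (refl u) == 0%VS.
Proof. by apply/lker0P; exact: inv_inj (reflK u). Qed.

Lemma refl_conj (g : 'End(V)) u :
  lker g == 0%VS -> (forall x y, '[g x, g y] = '[x, y]) ->
  (g \o refl u \o g^-1)%VF = refl (g u).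
Proof.
move=> g_inj g_iso; apply/lfunP => y; rewrite !comp_lfunE /=.
rewrite !reflE linearB linearZ /= lker0_lfunVK //.
by rewrite -(g_iso (g^-1%VF y)) lker0_lfunVK // g_iso.
Qed.

Lemma enddet_refl u : u != 0 -> enddet (refl u) = -1.
Proof.
move=> u0; rewrite /enddet; set b := vbasis _.
have bP : basis_of {:V} b := vbasisP _.
(* In coordinates the reflection is 1 minus the column [c] times the row of coordinates of [u]; the
   opposite product is 2, whence the determinant 1 - 2. *)
pose c : 'cV_(\dim {:V}) := \col_i (2 * '[b`_i, u] / '[u, u]).
have -> : mxof b b (refl u) = 1%:M - c *m rVof b u.
  apply/row_matrixP => i; rewrite !rowE mul_mxof vecof_delta reflE.
  rewrite linearB linearZ /= mulmxBr mulmx1 mulmxA -!rowE.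
  congr (_ - _); last first.
    by rewrite -mul_scalar_mx; congr (_ *m _); apply/matrixP => ? ?; rewrite !ord1 !mxE mulr1n.
  by rewrite -(vecof_delta b) vecofK.
rewrite det_1Bmul mxE.
suff -> : \sum_j rVof b u 0 j * c j 0 = 2 by lra.
transitivity (2 * '[u, u] / '[u, u]); last by rewrite mulfK ?dot_eq0.
have uE : '[u, u] = \sum_j rVof b u 0 j * '[b`_j, u].
  rewrite {1}(coord_basis bP (memvf u)) dot_suml.
  by apply: eq_bigr => j _; rewrite !mxE dotZl.
rewrite [X in _ = 2 * X / _]uE mulr_sumr mulr_suml.
by apply: eq_bigr => j _; rewrite !mxE; ring.
Qed.

End DotGeometry.

(** * Extension of scalars from X to V *)

Section RealExtension.
Variables (R : realType) (X Xc : vectType int) (V : vectType R).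
Variables (pair : {bilinear X -> Xc -> int | *%R & *%R}).
Variable iota : {additive X -> V}.

Lemma iota_scale (n : int) x : iota (n *: x) = n%:~R *: iota x.
Proof. by rewrite scaler_int -[n in LHS]intz scaler_int raddfMz. Qed.

(** Packaged as an additive map into V so that the universal property extends it to an endomorphism
    of V. *)
Definition iota_reflection a (ac : Xc) x := iota (reflection pair a ac x).

Fact iota_reflection_additive a ac : zmod_morphism (iota_reflection a ac).
Proof.
move=> x y; rewrite /iota_reflection -raddfB; congr (iota _).
rewrite /reflection linearBl scalerBl !opprB [_ *: a - _]addrC addrACA.
by rewrite [- y + _]addrC.
Qed.
HB.instance Definition _ a ac :=
  GRing.isZmodMorphism.Build X V (iota_reflection a ac)
    (iota_reflection_additive a ac).

Definition pair_real (ac : Xc) (x : X) : R^o := (pair x ac)%:~R.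

Fact pair_real_additive ac : zmod_morphism (pair_real ac).
Proof. by move=> x y; rewrite /pair_real linearBl intrB. Qed.
HB.instance Definition _ ac :=
  GRing.isZmodMorphism.Build X R^o (pair_real ac) (pair_real_additive ac).

Hypothesis iota_ext : real_extension iota.

Lemma real_extension_unique (W : lmodType R) (F G : {linear V -> W}) :
  (forall x, F (iota x) = G (iota x)) -> F =1 G.
Proof.
move=> FG; have [H [_ HU]] := iota_ext (F \o iota).
by move=> v; rewrite (HU F) // (HU G) // => x; rewrite -FG.
Qed.

(** Pairing with [ac] extends to a linear functional on V that is nonzero at [iota a]. *)
Lemma iota_neq0 a (ac : Xc) : pair a ac != 0 -> iota a != 0.
Proof.
move=> aac; have [F [Fpair _]] := iota_ext (pair_real ac).
apply: contra_neq aac => a0; have := Fpair a; rewrite a0 linear0 /pair_real.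
by move/esym/eqP; rewrite intr_eq0 => /eqP.
Qed.

End RealExtension.

(** * Roots and the Weyl group in Euclidean terms *)

Section RootGeometry.
Variables (R : realType) (X Xc : vectType int).
Variables (pair : {bilinear X -> Xc -> int | *%R & *%R}) (V : vectType R).
Variables (iota : {additive X -> V}) (coroot : X -> Xc) (Phi : {fset X}).
Variable form : {dot V for idfun}.
Local Notation "''[' u , v ]" := (form u v) (format "''[' u ,  v ]").
Local Notation W := (weyl_group iota pair coroot Phi).
Local Notation s_ a := (reflection pair a (coroot a)).

Hypothesis iota_ext : real_extension iota.
Hypothesis Phi_root : root_axioms pair coroot Phi.
Hypothesis Phi_reduced : reduced iota Phi.
Hypothesis W_isometry : forall w, W w -> forall u v, '[w u, w v] = '[u, v].

Lemma root_pair a : a \in Phi -> pair a (coroot a) = 2.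
Proof. by case: Phi_root => _ _ + _; apply. Qed.

Lemma root_reflection a b : a \in Phi -> b \in Phi -> s_ a b \in Phi.
Proof. by case: Phi_root => _ _ _; apply. Qed.

Lemma root_neq0 a : a \in Phi -> iota a != 0.
Proof. by move=> aP; apply: (iota_neq0 (pair := pair) iota_ext (ac := coroot a)); rewrite root_pair. Qed.

Lemma root_norm_gt0 a : a \in Phi -> 0 < '[iota a, iota a].
Proof. by rewrite dot_gt0; exact: root_neq0. Qed.

Lemma reflection_self a : a \in Phi -> s_ a a = - a.
Proof.
move=> aP; rewrite /reflection root_pair // scaler_nat mulr2n.
by rewrite opprD addrA subrr add0r.
Qed.

Lemma root_opp a : a \in Phi -> - a \in Phi.
Proof. by move=> aP; rewrite -reflection_self // root_reflection. Qed.

Lemma weyl_reflection (s : 'End(V)) a :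
  a \in Phi -> (forall x, s (iota x) = iota (s_ a x)) -> W s.
Proof. by move=> aP sE G _; apply; exists a. Qed.

(** The extension of [s_ a] to V lies in W, so it is an isometry; comparing the forms of (x, a) and
    of its image, where a goes to -a, gives the formula. It makes [s_ a] the orthogonal reflection
    in [iota a]. *)
Lemma pairE x a : a \in Phi ->
  (pair x (coroot a))%:~R * '[iota a, iota a] = 2 * '[iota x, iota a].
Proof.
move=> aP; have [F [FE _]] := iota_ext (iota_reflection pair iota a (coroot a)).
have {}FE y : F (iota y) = iota (s_ a y) := FE y.
have Ws : W (linfun F) by apply: (weyl_reflection aP) => y; rewrite lfunE FE.
have := W_isometry Ws (iota x) (iota a).
rewrite !lfunE !FE reflection_self // raddfN dotNr.
rewrite raddfB iota_scale dotBl dotZl => e.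
by lra.
Qed.

Lemma refl_root a : a \in Phi -> forall x, refl form (iota a) (iota x) = iota (s_ a x).
Proof.
move=> aP x; rewrite reflE -pairE // mulfK ?dot_eq0 ?root_neq0 //.
by rewrite raddfB iota_scale.
Qed.

Lemma generatorE (s : 'End(V)) a :
  a \in Phi -> (forall x, s (iota x) = iota (s_ a x)) -> s = refl form (iota a).
Proof.
move=> aP sE; apply/lfunP/(real_extension_unique iota_ext) => x.
by rewrite /= sE refl_root.
Qed.

Lemma weyl_refl a : a \in Phi -> W (refl form (iota a)).
Proof. by move=> aP; apply: (weyl_reflection aP) => x; rewrite refl_root. Qed.

Lemma dot_iota_reflection a x y : a \in Phi ->
  '[iota (s_ a x), iota y] = '[iota x, iota (s_ a y)].
Proof. by move=> aP; rewrite -!refl_root // refl_adjoint. Qed.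

Lemma reflectionK a : a \in Phi -> involutive (s_ a).
Proof.
move=> aP x; rewrite /reflection linearBl linearZl_LR root_pair //.
by rewrite mulr_natr mulr2n opprD addNKr scaleNr opprK subrK.
Qed.

(** If one of the two Cartan integers is -1, a reflection produces the sum. Otherwise both are at
    most -2, which forces the squared norm of [iota b + iota a] to be at most 0. *)
Lemma root_add a b : a \in Phi -> b \in Phi -> b != - a ->
  '[iota b, iota a] < 0 -> b + a \in Phi.
Proof.
move=> aP bP ba ab_lt0.
have [aN bN] := (root_norm_gt0 aP, root_norm_gt0 bP).
have eb := pairE b aP; have ea := pairE a bP; rewrite (dotC _ (iota a)) in ea.
have [b1|b1] := eqVneq (pair b (coroot a)) (-1).
  by have := root_reflection aP bP; rewrite /reflection b1 scaleN1r opprK.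
have [a1|a1] := eqVneq (pair a (coroot b)) (-1).
  by have := root_reflection bP aP; rewrite /reflection a1 scaleN1r opprK addrC.
have le_2 (n : int) (N : R) : n != -1 -> 0 < N ->
    n%:~R * N = 2 * '[iota b, iota a] -> '[iota b, iota a] <= - N.
  move=> n1 N0 e; have: (n%:~R : R) < 0 by nra.
  rewrite ltrz0 => n_lt0; have : n <= -2 by lia.
  by rewrite -(ler_int R) => n_le; nra.
have la := le_2 _ _ b1 aN eb; have lb := le_2 _ _ a1 bN ea.
have : ~~ (0 < '[iota b + iota a, iota b + iota a]).
  by rewrite !(dotDl, dotDr) (dotC _ (iota a)) -leNgt; lra.
rewrite dot_gt0 negbK addr_eq0 => /eqP e.
(* The equality [iota b = - iota a] in V is brought back to X by reducedness. *)
have [|ba'|/eqP] := Phi_reduced (c := -1) aP bP; first by rewrite scaleN1r.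
  by move: ab_lt0; rewrite ba' ltNge ltW.
by rewrite (negPf ba).
Qed.

(** * The product of the positive roots and the reflections in W *)

Definition half_system (H : {fset X}) :=
  H `<=` Phi /\ {in Phi, forall b, (- b \in H) = (b \notin H)}.

Lemma half_system_exists : exists H, half_system H.
Proof.
have [|x _ x_reg] := avoid_hyperplanes (form := form) (U := fullv)
    (s := [seq iota b | b <- Phi]).
  move=> _ /mapP[b bP ->]; exists (iota b); first exact: memvf.
  by rewrite dot_eq0 root_neq0.
exists [fset b in Phi | 0 < '[x, iota b]]; split; first exact: fset_sub.
move=> b bP; rewrite !inE /= root_opp // bP /= raddfN dotNr oppr_gt0.
have := x_reg _ (map_f iota bP); case: ltgtP => //.
Qed.

(** The skew-invariant polynomial function of W, evaluated at [x]. *)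
Definition half_product (H : {fset X}) x := \prod_(b <- H) '[x, iota b].

(** The factor of [a] changes sign, and the reflection permutes the other factors up to signs; the
    product of those signs is found by evaluating on the hyperplane of [a]. *)
Lemma half_product_refl H a x : half_system H -> a \in Phi ->
  half_product H (refl form (iota a) x) = - half_product H x.
Proof.
move=> [HPhi Hopp]; wlog aH : a / a \in H => [hwlog aP|aP].
  have [/hwlog|aH] := boolP (a \in H); first exact.
  have /hwlog : - a \in H by rewrite Hopp.
  by rewrite root_opp // raddfN reflN => ->.
have HP b : b \in H -> b \in Phi by apply: (fsubsetP HPhi).
set s := refl _ _; pose Q y := \prod_(b <- H `\ a) '[y, iota b].
have prodE y : half_product H y = '[y, iota a] * Q y.
  by rewrite /half_product (big_fsetD1 a).
(* [f b] is the representative in [H] of the pair of [s_ a b] and its opposite, and [d b] is the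
   sign relating it to [s_ a b]. *)
pose f b := if s_ a b \in H then s_ a b else - s_ a b.
pose d b : R := if s_ a b \in H then 1 else -1.
have sP b : b \in H -> s_ a b \in Phi by move/HP; exact: root_reflection.
have fH b : b \in H -> f b \in H.
  by move=> /sP sb; rewrite /f; case: ifPn; rewrite // -Hopp.
have f_sign b : f b = s_ a b \/ f b = - s_ a b.
  by rewrite /f; case: ifP; [left|right].
have sN b : s_ a (- b) = - s_ a b.
  by rewrite /reflection linearNl scaleNr opprB opprK addrC.
have Hne b c : b \in H -> c \in H -> b != - c.
  by move=> bH cH; apply: contraTneq bH => ->; rewrite Hopp ?HP // cH.
have f_stable b : b \in H `\ a -> f b \in H `\ a.
  rewrite !inE => /andP[ba bH]; rewrite fH // andbT.
  apply: contra_neq ba => fa.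
  have [e|e] := f_sign b; rewrite fa in e.
    have : b = - a by rewrite -(reflectionK aP b) -e reflection_self.
    by move/eqP; rewrite (negPf (Hne _ _ bH aH)).
  by rewrite -(reflectionK aP b) -[s_ a b]opprK -e sN reflection_self ?opprK.
have f_inj : {in H `\ a &, injective f}.
  move=> b c; rewrite !inE => /andP[_ bH] /andP[_ cH] fbc.
  have [e|e] : s_ a b = s_ a c \/ s_ a b = s_ a (- c).
  - rewrite sN; move: fbc.
    have [->|->] := f_sign b; have [->|->] := f_sign c => e; rewrite ?e; auto.
    + by right; rewrite -e opprK.
    + by left; apply: oppr_inj.
  - by rewrite -(reflectionK aP b) e reflectionK.
  - have /eqP : b = - c by rewrite -(reflectionK aP b) e reflectionK.
    by rewrite (negPf (Hne _ _ bH cH)).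
have Qs y : Q (s y) = (\prod_(b <- H `\ a) d b) * Q y.
  have -> : Q y = \prod_(b <- H `\ a) '[y, iota (f b)].
    rewrite -(big_map f xpredT (fun b => '[y, iota b])).
    by apply: perm_big; rewrite perm_sym perm_map_stable ?fset_uniq.
  rewrite -big_split /=; apply: eq_bigr => b _.
  rewrite refl_adjoint refl_root // /d /f.
  case: (s_ a b \in H) => /=; first by rewrite mul1r.
  by rewrite raddfN dotNr mulrN mulN1r opprK.
(* By reducedness no other root of [H] is proportional to [a], so some [y] orthogonal to [a] has
   [Q y] nonzero. As [s] fixes [y], the total sign is 1. *)
have d1 : \prod_(b <- H `\ a) d b = 1.
  have [|y] := avoid_hyperplanes (form := form) (U := orthov form <[iota a]>)
      (s := [seq iota b | b <- H `\ a]).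
    move=> _ /mapP[b /fsetD1P[ba bH] ->]; apply: contrapT => /forall2NP nob.
    have /Phi_reduced : iota b = ('[iota b, iota a] / '[iota a, iota a]) *: iota a.
      apply: orth_sub_line (root_neq0 aP) _ => y ya.
      have [] := nob y; first by rewrite mem_orth_line ya eqxx.
      by move/negP/negPn/eqP.
    by case=> [//||/eqP|/eqP]; rewrite ?(negPf ba) ?(negPf (Hne _ _ bH aH)) ?HP.
  rewrite mem_orth_line => /eqP ya yreg.
  have Qy : Q y != 0.
    rewrite prodf_seq_neq0; apply/allP => b bH; apply: yreg; exact: map_f.
  by apply: (mulIf Qy); rewrite -Qs mul1r /s refl_orth.
by rewrite !prodE Qs d1 mul1r refl_adjoint refl_id ?root_neq0 // dotNr mulNr.
Qed.

(** The invertible maps obeying this rule form a subgroup containing the generators of W. *)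
Lemma half_product_weyl H w x : half_system H -> W w ->
  half_product H (w x) = enddet w * half_product H x.
Proof.
move=> Hhalf; pose G : set 'End(V) := [set f | GL f /\
  forall x, half_product H (f x) = enddet f * half_product H x].
suff : W w -> G w by move=> WG /WG[].
apply; first split.
- by move=> f [].
- split; first by apply/lker0P => y z; rewrite !id_lfunE.
  by move=> y; rewrite enddet1 id_lfunE mul1r.
- move=> f g [f0 fE] [g0 gE]; split.
    apply/lker0P => y z; rewrite !comp_lfunE => /(elimT lker0P f0).
    exact: (elimT lker0P g0).
  by move=> y; rewrite comp_lfunE fE gE enddet_comp mulrA.
- move=> f [f0 fE]; split; first by apply/lker0P; exact: can_inj (lker0_lfunVK f0).
  move=> y; rewrite -[in RHS](lker0_lfunVK f0 y) fE mulrA -enddet_comp.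
  by rewrite lker0_compVf // enddet1 mul1r.
move=> s [a aP /(generatorE aP) ->]; split; first exact: refl_in_GL.
by move=> y; rewrite half_product_refl // enddet_refl ?root_neq0 // mulN1r.
Qed.

(* The product of the positive roots changes sign under every reflection of W,
   hence vanishes on its hyperplane, which must therefore lie in the hyperplane
   of some root. *)
Lemma weyl_refl_root u : u != 0 -> W (refl form u) ->
  exists2 b, b \in Phi & exists2 c : R, 0 < c & u = c *: iota b.
Proof.
move=> u0 Wu; have [H Hhalf] := half_system_exists.
have HP b : b \in H -> b \in Phi by apply: (fsubsetP Hhalf.1).
suff [b bP ub] : exists2 b, b \in Phi & forall x, '[x, u] = 0 -> '[x, iota b] = 0.
  have bu := orth_sub_line u0 ub; set c := _ / _ in bu.
  have c0 : c != 0.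
    by apply: contraNneq (root_neq0 bP) => c0; rewrite bu c0 scale0r.
  have uE : u = c^-1 *: iota b by rewrite bu scalerK.
  case: (ltgtP 0 c) => [c_gt0|c_lt0|c_eq0].
  - by exists b => //; exists c^-1; rewrite ?invr_gt0.
  - exists (- b); first exact: root_opp.
    exists (- c^-1); first by rewrite oppr_gt0 invr_lt0.
    by rewrite raddfN scaleNr scalerN opprK.
  - by rewrite -c_eq0 eqxx in c0.
apply: contrapT => /forall2NP nob.
have [|y] := avoid_hyperplanes (form := form) (U := orthov form <[u]>)
    (s := [seq iota b | b <- H]).
  move=> _ /mapP[b bH ->]; have [/(_ (HP b bH))//|/existsNP[x]] := nob b.
  by move/not_implyP => [/eqP xu /eqP xb]; exists x; rewrite ?mem_orth_line.
rewrite mem_orth_line => /eqP yu yreg.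
have : half_product H y != 0.
  by rewrite prodf_seq_neq0; apply/allP => b bH; apply: yreg; exact: map_f.
have := half_product_weyl y Hhalf Wu.
by rewrite enddet_refl // refl_orth // => e; apply/negP/negPn/eqP; lra.
Qed.

(** * Action of the normalizer of W on the rays spanned by roots *)

Lemma normalizer_root (g : 'End(V)) a : GL_normalizer W g ->
  (forall u v, '[g u, g v] = '[u, v]) -> a \in Phi ->
  exists2 b, b \in Phi & exists2 c : R, 0 < c & g (iota a) = c *: iota b.
Proof.
move=> [g0 gW] g_iso aP; apply: weyl_refl_root.
  by rewrite -(dot_eq0 form) g_iso dot_eq0 root_neq0.
(* The reflection in [g (iota a)] is the conjugate by [g] of a reflection in W, hence lies in W. *)
rewrite -refl_conj // -gW; exists (refl form (iota a)) => //.
exact: weyl_refl.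
Qed.

Lemma root_actionP (g : 'End(V)) a : GL_normalizer W g ->
  (forall u v, '[g u, g v] = '[u, v]) -> a \in Phi ->
  root_action iota Phi g a \in Phi /\
  exists2 c : R, 0 < c & g (iota a) = c *: iota (root_action iota Phi g a).
Proof.
move=> gN g_iso aP; rewrite /root_action; case: xgetP => [b -> //|nob].
by have [b bP bE] := normalizer_root gN g_iso aP; case: (nob b).
Qed.

Lemma reflectionD a x y : s_ a (x + y) = s_ a x + s_ a y.
Proof. by rewrite /reflection linearDl scalerDl opprD addrACA. Qed.

Lemma pair_lt0 x a : a \in Phi ->
  (pair x (coroot a) < 0) = ('[iota x, iota a] < 0).
Proof.
move=> aP; have aN := root_norm_gt0 aP.
by rewrite -(ltrz0 R) -(pmulr_llt0 _ aN) pairE // pmulr_rlt0.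
Qed.

(** * Parabolic subsets and the sum of the nilradical *)

Section Parabolic.
Variable Psi : {fset X}.
Hypothesis Psi_parabolic : parabolic Phi Psi.

Definition nilradical : {fset X} := [fset b in Psi | - b \notin Psi].

Lemma mem_nilradical b : (b \in nilradical) = (b \in Psi) && (- b \notin Psi).
Proof. by rewrite !inE. Qed.

Lemma parabolic_root a : a \in Psi -> a \in Phi.
Proof. by case: Psi_parabolic => [[/fsubsetP PsiP _] _]; exact: PsiP. Qed.

Lemma parabolic_add a b : a \in Psi -> b \in Psi -> a + b \in Phi -> a + b \in Psi.
Proof. by case: Psi_parabolic => [[_ +] _]; apply. Qed.

(** The nilradical is an ideal of [Psi]: if -(b + a) were in [Psi], adding a would put -b there. *)
Lemma nilradical_add a b :
  a \in Psi -> b \in nilradical -> b + a \in Phi -> b + a \in nilradical.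
Proof.
rewrite !mem_nilradical => aPsi /andP[bPsi Nb] baP.
rewrite parabolic_add //=; apply: contra Nb => Nba.
have bE : - b = - (b + a) + a by rewrite opprD subrK.
by rewrite bE parabolic_add // -bE root_opp // parabolic_root.
Qed.

(* Induction on k = -<b, a^v>: when k >= 2, b + a is again in the nilradical, has
   pairing -(k - 2), and s_a b = s_a (b + a) + a. *)
Lemma nilradical_reflection a b : a \in Psi -> b \in nilradical ->
  pair b (coroot a) <= 0 -> s_ a b \in nilradical.
Proof.
move=> aPsi bN ba_le0; have aP := parabolic_root aPsi.
have [k] : exists k : nat, pair b (coroot a) = - k%:Z.
  by exists `|pair b (coroot a)|%N; lia.
elim/ltn_ind: k b bN {ba_le0} => k IH b bN bk.
have sE : s_ a b = b + k%:Z *: a by rewrite /reflection bk scaleNr opprK.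
have [k0|k_gt0] := posnP k; first by rewrite sE k0 scale0r addr0.
have bP : b \in Phi by move: bN; rewrite mem_nilradical => /andP[/parabolic_root].
have baN : b + a \in nilradical.
  apply: nilradical_add => //; apply: root_add => //.
    move: bN; rewrite mem_nilradical => /andP[_].
    by apply: contraNneq => ->; rewrite opprK.
  by rewrite -pair_lt0 // bk; lia.
(* The case k = 1 is separate: [b + a] then pairs to 1, which the truncated [k - 2] does not
   describe. *)
have [k1|k_neq1] := eqVneq k 1%N; first by rewrite sE k1 scale1r.
have /IH/(_ _ baN) sba : (k - 2 < k)%N by lia.
have sbE : s_ a b = s_ a (b + a) + a by rewrite reflectionD reflection_self // subrK.
rewrite sbE nilradical_add ?sba -?sbE ?root_reflection //.
by rewrite linearDl root_pair // bk; lia.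
Qed.

Let rho2 := \sum_(b <- nilradical) iota b.

(** The roots b of the nilradical that [s_ a] keeps inside it cancel, since [s_ a] permutes them and
    negates (b|a). By [nilradical_reflection] the remaining ones have (b|a) nonnegative. *)
Lemma nilradical_sum_ge0 a : a \in Psi ->
  0 <= '[rho2, iota a] /\ (a \in nilradical -> 0 < '[rho2, iota a]).
Proof.
move=> aPsi; have aP := parabolic_root aPsi.
have NP b : b \in nilradical -> b \in Phi.
  by rewrite mem_nilradical => /andP[/parabolic_root].
pose q b := s_ a b \in nilradical; pose f b := '[iota b, iota a].
have sum0 : \sum_(b <- nilradical | q b) f b = 0.
  rewrite -big_filter; set t := [seq b <- _ | _].
  have pt : perm_eq (map (s_ a) t) t.
    apply: perm_map_stable; first by rewrite filter_uniq ?fset_uniq.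
      by move=> b c _ _ /(congr1 (s_ a)); rewrite !reflectionK.
    move=> b; rewrite !mem_filter /q => /andP[sbN bN].
    by rewrite sbN reflectionK // bN.
  have : \sum_(b <- t) f b = - \sum_(b <- t) f b.
    rewrite -{1}(perm_big _ pt) big_map -sumrN; apply: eq_bigr => b _.
    by rewrite /f dot_iota_reflection // reflection_self // raddfN dotNr.
  by move=> e; lra.
have rhoE : '[rho2, iota a] = \sum_(b <- [seq b <- nilradical | ~~ q b]) f b.
  by rewrite dot_suml (bigID q) /= sum0 add0r big_filter.
have f_ge0 b : b \in [seq b <- nilradical | ~~ q b] -> 0 <= f b.
  rewrite mem_filter => /andP[+ bN]; apply: contraNT; rewrite -ltNge -pair_lt0 //.
  by move=> /ltW; exact: nilradical_reflection.
rewrite rhoE; split.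
  by rewrite big_seq; apply: sumr_ge0 => b /f_ge0.
(* Since [s_ a] sends a to -a, outside the nilradical, a itself is among the remaining roots and
   contributes (a|a) > 0. *)
move=> aN; rewrite (bigD1_seq a) ?filter_uniq ?fset_uniq //=; last first.
  rewrite mem_filter aN /q reflection_self // mem_nilradical andbT.
  by move: aN; rewrite mem_nilradical => /andP[_ /negPf->].
rewrite ltr_pwDl ?root_norm_gt0 // big_seq_cond.
by apply: sumr_ge0 => b /andP[/f_ge0].
Qed.

(** * Averaging over Gamma *)

Variable Gamma : {fset 'End(V)}.
Hypothesis Gamma_group : GL_subgroup [set` Gamma].
Hypothesis Gamma_normal : ([set` Gamma] `<=` GL_normalizer W)%classic.
Hypothesis Gamma_isometry :
  forall g, g \in Gamma -> forall u v, '[g u, g v] = '[u, v].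

Lemma Gamma_inj g : g \in Gamma -> lker g == 0%VS.
Proof. by case: Gamma_group => + _ _ _; apply. Qed.

(** The sum of the orbit of [rho2] is fixed because left translation permutes Gamma. Its terms pair
    nonnegatively with [Psi]: (g rho2|a) = (rho2|g^-1 a), and g^-1 a is a positive multiple of a
    root of [Psi] by stability. The term g = 1 gives strictness. *)
Lemma stable_parabolic_vector : stable iota Phi Gamma Psi ->
  exists2 v, (forall g, g \in Gamma -> g v = v) &
  forall a, a \in Psi -> 0 <= '[v, iota a] /\ (a \in nilradical -> 0 < '[v, iota a]).
Proof.
case: Gamma_group => _ G1 GM GV Psi_stable.
exists (\sum_(g <- Gamma) g rho2).
  move=> h hG; rewrite linear_sum /=.
  rewrite -[RHS](perm_big _ (perm_map_stable (f := fun g => (h \o g)%VF) (fset_uniq _) _ _)).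
  - by rewrite big_map; apply: eq_bigr => g _; rewrite comp_lfunE.
  - by move=> g g' _ _ /(congr1 (comp_lfun h^-1%VF)); rewrite !lker0_compKf ?Gamma_inj.
  - by move=> g gG; exact: GM.
move=> a aPsi; have aP := parabolic_root aPsi.
have g_ge0 g : g \in Gamma -> 0 <= '[g rho2, iota a].
  move=> gG; have g'G : (g^-1)%VF \in Gamma := GV _ gG.
  have [_ [c c_gt0 ga]] := root_actionP (Gamma_normal g'G) (Gamma_isometry g'G) aP.
  rewrite -(Gamma_isometry g'G) lker0_lfunK ?Gamma_inj // ga dotZr.
  rewrite pmulr_rge0 //.
  by have [] := nilradical_sum_ge0 (Psi_stable _ g'G _ aPsi).
rewrite dot_suml; split; first by rewrite big_seq; apply: sumr_ge0.
move=> aN; rewrite (bigD1_seq \1%VF) ?fset_uniq //=.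
rewrite ltr_pwDl ?id_lfunE //; first by have [_] := nilradical_sum_ge0 aPsi; apply.
by rewrite big_seq_cond; apply: sumr_ge0 => g /andP[/g_ge0].
Qed.

End Parabolic.
End RootGeometry.

(** * Fixed vectors and the closure of [Sigma] *)

Lemma mem_fset_opp (X : vectType int) (P : {fset X}) a :
  (a \in fset_opp P) = (- a \in P).
Proof.
apply/imfsetP/idP => [[b bP ->]|aP]; first by rewrite opprK.
by exists (- a); rewrite ?opprK.
Qed.

Lemma mem_invariants (R : realType) (V : vectType R) (Gamma : {fset 'End(V)}) v :
  reflect (forall g, g \in Gamma -> g v = v) (v \in invariants Gamma).
Proof.
have -> : v \in invariants Gamma = all (fun g : 'End(V) => g v == v) Gamma.
  rewrite /invariants; elim: (enum_fset Gamma) => [|g s IH].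
    by rewrite big_nil memvf.
  by rewrite big_cons memv_cap IH; congr andb; apply/fixedSpaceP/eqP.
by apply: (iffP allP) => vG g /vG /eqP.
Qed.

Theorem corollary2p11 (R : realType) (X Xc : vectType int)
    (pair : {bilinear X -> Xc -> int | *%R & *%R})
    (V : vectType R) (iota : {additive X -> V})
    (coroot : X -> Xc) (Phi : {fset X})
    (Gamma : {fset 'End(V)}) (form : {dot V for idfun}) (theta : 'End(V))
    (Sigma : {fset X}) :
  perfect_pairing pair ->
  real_extension iota ->
  root_axioms pair coroot Phi ->
  reduced iota Phi ->
  let W := weyl_group iota pair coroot Phi in
  GL_subgroup [set` Gamma] ->
  ([set` Gamma] `<=` GL_normalizer W)%classic ->
  (forall w g, W w -> g \in Gamma ->
     forall u v, form ((w \o g)%VF u) ((w \o g)%VF v) = form u v) ->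
  orthogonal_projection form (invariants Gamma) theta ->
  Sigma `<=` Phi ->
  [/\ split_levi iota Phi Gamma (levi_closure iota Phi theta Sigma),
      Sigma `<=` levi_closure iota Phi theta Sigma,
      (forall Lambda : {fset X}, split_levi iota Phi Gamma Lambda ->
         Sigma `<=` Lambda -> levi_closure iota Phi theta Sigma `<=` Lambda) &
      split_levi iota Phi Gamma Sigma <->
        Sigma = levi_closure iota Phi theta Sigma].
Proof.
move=> _ iota_ext Phi_root Phi_red W G_group G_normal WG_iso thetaP SigmaPhi.
have G1 : \1%VF \in Gamma by case: G_group.
have W1 : W \1%VF by move=> H [].
have W_iso w : W w -> forall u v, form (w u) (w v) = form u v.
  by move=> Ww u v; have := WG_iso _ _ Ww G1 u v; rewrite !comp_lfunE !id_lfunE.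
have G_iso g : g \in Gamma -> forall u v, form (g u) (g v) = form u v.
  by move=> gG u v; have := WG_iso _ _ W1 gG u v; rewrite !comp_lfunE !id_lfunE.
have theta_dot v u : v \in invariants Gamma -> form v (theta u) = form v u.
  move=> vG; have [_ /(_ v vG)] := thetaP u.
  by rewrite dotBl !(dotC form v) => e; lra.
have act := root_actionP iota_ext Phi_root Phi_red W_iso.
set C := levi_closure _ _ _ _.
have memC a : (a \in C) =
    (a \in Phi) && (theta (iota a) \in theta @: real_span iota Sigma)%VS.
  by rewrite !inE /= memv_preim.
have SigmaC : Sigma `<=` C.
  apply/fsubsetP => a aS; rewrite memC (fsubsetP SigmaPhi) //=.
  by rewrite memv_img // memv_span // map_f.
have C_split : split_levi iota Phi Gamma C.
  have [|v] := avoid_hyperplanes (form := form)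
      (U := (invariants Gamma :&: orthov form (theta @: real_span iota Sigma))%VS)
      (s := [seq theta (iota a) | a <- Phi `\` C]).
    move=> _ /mapP[a /fsetDP[aP aC] ->].
    set T := (theta @: _)%VS.
    have TE : T = <<map theta [seq iota b | b <- Sigma]>>%VS by rewrite -limg_span.
    (* The witness for [a] is the component of [theta (iota a)] orthogonal to [T]: it is fixed by
       Gamma, as [T] consists of fixed vectors, and nonzero, as [a] is outside [C]. *)
    have [p] := span_orthogonal_decomposition form
      (map theta [seq iota b | b <- Sigma]) (theta (iota a)).
    rewrite -TE => pT p_orth; exists (theta (iota a) - p).
      rewrite memv_cap; apply/andP; split; last by apply/mem_orthovP => y /p_orth.
      have /memv_imgP[z _ ->] := pT.
      by apply: memvB; [have [] := thetaP (iota a) | have [] := thetaP z].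
    have -> : form (theta (iota a) - p) (theta (iota a)) =
        form (theta (iota a) - p) (theta (iota a) - p).
      by rewrite [RHS]dotBr (p_orth p) // subr0.
    rewrite dot_eq0 subr_eq0; apply: contraNneq aC => e.
    by rewrite memC aP /= e.
  rewrite memv_cap => /andP[vG /mem_orthovP vT] v_reg.
  have vC a : a \in Phi -> (a \in C) = (form v (iota a) == 0).
    move=> aP; rewrite -theta_dot //; have [aC|aC] := boolP (a \in C).
      by move: aC; rewrite memC => /andP[_ /vT /eqP ->].
    by apply/esym/negbTE/v_reg/map_f; rewrite in_fsetD aC.
  pose Psi := [fset a in Phi | 0 <= form v (iota a)].
  have memPsi a : (a \in Psi) = (a \in Phi) && (0 <= form v (iota a)).
    by rewrite !inE.
  have memPsiN a : (- a \in Psi) = (a \in Phi) && (form v (iota a) <= 0).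
    rewrite memPsi raddfN dotNr oppr_ge0; congr andb.
    by apply/idP/idP => /(root_opp Phi_root) //; rewrite opprK.
  exists Psi; split; first split; first split.
  - exact: fset_sub.
  - move=> a b; rewrite !memPsi => /andP[_ va] /andP[_ vb] ->.
    by rewrite raddfD dotDr addr_ge0.
  - apply/fsetP => a; rewrite in_fsetU mem_fset_opp memPsi memPsiN.
    by rewrite -andb_orr le_total andbT.
  - move=> g gG a; rewrite !memPsi => /andP[aP va].
    (* As g fixes v, (v|a) = (g v|g a) = (v|g a), a positive multiple of the pairing of v with the
       image root. *)
    have [bP [c c_gt0 gE]] := act g a (G_normal g gG) (G_iso g gG) aP.
    rewrite bP /= -(pmulr_rge0 _ c_gt0) -dotZr -gE.
    by rewrite -[v](elimT (mem_invariants _ _) vG g gG) G_iso.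
  - apply/fsetP => a; rewrite in_fsetI mem_fset_opp memPsi memPsiN.
    have [aP|aP] := boolP (a \in Phi); last by rewrite memC (negPf aP).
    by rewrite vC //= eq_le andbC.
have C_min (L : {fset X}) :
    split_levi iota Phi Gamma L -> Sigma `<=` L -> C `<=` L.
  move=> [Psi [Psi_par Psi_stable ->]] SigmaL.
  have [v vG vPsi] := stable_parabolic_vector iota_ext Phi_root Phi_red W_iso
    Psi_par G_group G_normal G_iso Psi_stable.
  have vI : v \in invariants Gamma by apply/mem_invariants.
  (* For b in [Sigma] both b and -b lie in [Psi], so (v|b) = 0; through [theta] this passes to all
     of [C]. *)
  have v0 a : a \in C -> form v (iota a) = 0.
    rewrite memC => /andP[_ /memv_imgP[z zS e]].
    rewrite -theta_dot // e theta_dot //; apply: dot_span_eq0 zS.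
    move=> _ /mapP[b /(fsubsetP SigmaL) + ->].
    rewrite in_fsetI mem_fset_opp => /andP[/vPsi[bge _] /vPsi[]].
    by rewrite raddfN dotNr => ? _; lra.
  (* A root of [C] in [Psi] whose opposite is outside [Psi] would be in the nilradical, where v is
     strictly positive. *)
  have CPsi a : a \in C -> a \in Psi -> - a \in Psi.
    move=> /v0 va aPsi; apply: contraTT isT => Na.
    by have [_] := vPsi a aPsi; rewrite va ltxx mem_nilradical aPsi Na => /(_ isT).
  apply/fsubsetP => a aC; rewrite in_fsetI mem_fset_opp.
  have aP : a \in Phi by move: aC; rewrite memC => /andP[].
  have := aP; have [_ {1}<-] := Psi_par; rewrite in_fsetU mem_fset_opp.
  case/orP => [aPsi|NaPsi]; first by rewrite aPsi CPsi.
  rewrite NaPsi andbT; apply: contraTT isT => Na.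
  have [_] := vPsi _ NaPsi; rewrite raddfN dotNr v0 // oppr0 ltxx.
  by rewrite mem_nilradical NaPsi opprK Na => /(_ isT).
split=> //; split=> [Sigma_split|->] //.
(* Minimality is applied to [Sigma] itself. *)
by apply/eqP; rewrite eqEfsubset SigmaC C_min.
Qed.
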